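(* Let $1\leq p,q\leq \infty$ be such that $\frac{1}{p}+\frac{1}{q}=1$. Given $\alpha>0$, $(a,b)\in\mathbb{R}^2$ with $a<b$, and $(f,g)\in L^p([a,b];\mathbb{R})\times L^q([a,b];\mathbb{R})$, we have $$\int_a^b \left(J_a^\alpha f\right)(x)g(x)\,dx=\int_a^b \left(J_b^\alpha g\right)(x)f(x)\,dx.$$
   Context: The exponential-integral function is $E_1(x)=\int_x^\infty \frac{e^{-t}}{t}\,dt$ for $x>0$. For $\alpha>0$, $a<b$ real and $f\in L^1([a,b];\mathbb{R})$, the left-sided and right-sided fractional integrals of first kind of order $\alpha$ of $f$ are, for a.e. $x\in[a,b]$, $$(J_a^\alpha f)(x)=\frac{1}{\alpha}\int_a^x E_1\left(\frac{x-t}{\alpha}\right)f(t)\,dt,\qquad (J_b^\alpha f)(x)=\frac{1}{\alpha}\int_x^b E_1\left(\frac{t-x}{\alpha}\right)f(t)\,dt.$$ The convention $1/\infty=0$ is used. *)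

(* Defs.v *)
From mathcomp Require Import all_boot all_order all_algebra.
From mathcomp Require Import all_classical all_reals all_analysis.

Set Implicit Arguments.
Unset Strict Implicit.
Unset Printing Implicit Defensive.

Import Order.TTheory GRing.Theory Num.Theory.
Import numFieldNormedType.Exports.

Local Open Scope classical_set_scope.
Local Open Scope ring_scope.

(* Only the values at x > 0 are meaningful: for x <= 0 the integral diverges
   and [Rintegral] returns a default value. *)
Definition E1 (R : realType) (x : R) : R :=
  \int[@lebesgue_measure R]_(t in `[x, +oo[) (expR (- t) / t).

(* E1 is evaluated at the meaningless point 0 only for t = x, which is a
   null set. At the points x where the integrand is not integrable, which form
   a null set for f in L^1, [Rintegral] returns a default value. *)
Definition fracint_left (R : realType) (alpha a : R) (f : R -> R) (x : R) : R :=
  alpha^-1 *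
    \int[@lebesgue_measure R]_(t in `[a, x]) (E1 ((x - t) / alpha) * f t).

Definition fracint_right (R : realType) (alpha b : R) (f : R -> R) (x : R) : R :=
  alpha^-1 *
    \int[@lebesgue_measure R]_(t in `[x, b]) (E1 ((t - x) / alpha) * f t).

(* L^p([a, b]; R), for 1 <= p <= +oo: the extension by zero belongs to
   L^p(R). The values of f outside [a, b] are unconstrained. Measurability is
   with respect to Borel sets, so f is a Borel representative of its class. *)
Definition Lp_itv (R : realType) (p : \bar R) (a b : R) (f : R -> R) : Prop :=
  f \_ `[a, b] \in Lfun (@lebesgue_measure R) p.

(* Main.v *)
Require Import Defs.
From mathcomp Require Import all_boot all_order all_algebra.
From mathcomp Require Import all_classical all_reals all_analysis.
From mathcomp Require Import ess_sup_inf measurable_realfun.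

Import Order.TTheory GRing.Theory Num.Theory.
Import numFieldNormedType.Exports.

Local Open Scope classical_set_scope.
Local Open Scope ring_scope.

(** Both sides are iterated integrals of the function
    [alpha^-1 * E1 ((x - t) / alpha) * f t * g x] on the triangle
    [a <= t <= x <= b], so the identity is Fubini's theorem once this function
    is integrable. By Tonelli, [E1] has integral 1 over the half-line, hence
    the kernel [alpha^-1 * E1 ((x - t) / alpha)] has integral at most 1 in each
    variable separately. When [p] and [q] are finite, Young's inequality
    [|f t * g x| <= |f t|^p / p + |g x|^q / q] bounds the product by terms
    depending on one variable only; otherwise one of the two functions is
    essentially bounded and the other one is integrable. *)

(* If [f] is measurable but not integrable, its integral is infinite or of the
   form [+oo - +oo], and [Rintegral] is 0 on both sides. *)
Lemma RintegralZl_measurable {d} {T : measurableType d} {R : realType}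
    (mu : {measure set T -> \bar R}) (D : set T) (f : T -> R) (c : R) :
  measurable D -> measurable_fun D f ->
  \int[mu]_(x in D) (c * f x) = c * \int[mu]_(x in D) f x.
Proof.
have Rintegral_junk (h : T -> R) : measurable D -> measurable_fun D h ->
    ~ mu.-integrable D (EFin \o h) -> \int[mu]_(x in D) h x = 0.
  move=> mD mh nih; rewrite /Rintegral integralE.
  have mEh : measurable_fun D (EFin \o h) by exact/measurable_EFinP.
  have p0 : (0 <= \int[mu]_(x in D) (EFin \o h)^\+ x)%E.
    exact: integral_ge0.
  have n0 : (0 <= \int[mu]_(x in D) (EFin \o h)^\- x)%E.
    exact: integral_ge0.
  (* The two parts add up to the integral of [|h|], which is infinite, so at least one of them is
     [+oo]. *)
  have : (\int[mu]_(x in D) (EFin \o h)^\+ x +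
          \int[mu]_(x in D) (EFin \o h)^\- x = +oo)%E.
    rewrite -ge0_integralD//; last 2 first.
    - exact: measurable_funepos.
    - exact: measurable_funeneg.
    apply/eqP; rewrite -leye_eq leNgt; apply/negP => foo; apply: nih.
    apply/integrableP; split => //.
    move: foo; apply: le_lt_trans.
    by rewrite -[X in (X <= _)%E]/(\int[mu]_(x in D) (abse \o (EFin \o h)) x)%E
      fune_abse.
  move: p0 n0; case: (integral _ _ _) => [r| |]//;
    by case: (integral _ _ _) => [s| |].
(* For [c != 0] the functions [f] and [c * f] are integrable together, so the default value occurs
   on both sides or on neither. *)
move=> mD mf; have [->|c0] := eqVneq c 0.
  by under eq_Rintegral do rewrite mul0r; rewrite Rintegral_cst// !mul0r.
have [fi|nfi] := pselect (mu.-integrable D (EFin \o f)).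
  exact: RintegralZl.
rewrite (Rintegral_junk f)// mulr0 Rintegral_junk//.
  exact: measurable_funM.
move=> cfi; apply: nfi.
apply: eq_integrable (integrableZl mD c^-1 cfi) => // x _ /=.
by rewrite -EFinM mulKf.
Qed.

(** * Schur test: integrability of products against a kernel *)

Section schur_test.
Context {d1 d2} {T1 : measurableType d1} {T2 : measurableType d2}
  {R : realType}.
Variable m1 : {sigma_finite_measure set T1 -> \bar R}.
Variable m2 : {sigma_finite_measure set T2 -> \bar R}.

(** By Tonelli, integrability is finiteness of the iterated integral of the absolute value in either
    order, and the swap exchanges the two orders. *)
Lemma integrable_swap (f : T1 * T2 -> \bar R) :
  (m1 \x m2)%E.-integrable setT f ->
  (m2 \x m1)%E.-integrable setT (f \o swap_pair).
Proof.
move=> fi; have mf := measurable_int _ fi.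
have mfs : measurable_fun setT (f \o swap_pair).
  exact: (measurableT_comp mf (@measurable_swap _ _ T2 T1)).
apply/integrable21ltyP; first exact: mfs.
exact/integrable12ltyP.
Qed.

(** Integrating [K z * |h z.2|] in the first variable first leaves at most [C * |h y|]. *)
Lemma integrable_kernel_snd (K : T1 * T2 -> R) (C : R) (h : T2 -> R) :
  measurable_fun setT K -> (forall z, 0 <= K z) ->
  (forall y, \int[m1]_x (K (x, y))%:E <= C%:E)%E ->
  m2.-integrable setT (EFin \o h) ->
  (m1 \x m2)%E.-integrable setT (fun z => (K z * h z.2)%:E).
Proof.
move=> mK K0 KC hi.
have mh : measurable_fun setT h.
  by apply/measurable_EFinP; exact: measurable_int hi.
have mKh : measurable_fun setT (fun z : T1 * T2 => (K z * h z.2)%:E).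
  by apply/measurable_EFinP/measurable_funM => //; exact: measurableT_comp.
apply/integrable21ltyP => //.
have /integrableP[_ hoo] := integrableZl measurableT C hi.
apply: le_lt_trans hoo; apply: ge0_le_integral => //.
- by move=> y _; exact: integral_ge0.
- apply: (measurable_fun_fubini_tonelli_G
    (fun z => `|(K z * h z.2)%:E|)%E) => //.
  exact: measurableT_comp.
- by apply: measurableT_comp => //; exact/measurable_funeM/measurable_EFinP.
move=> y _.
under eq_integral.
  move=> x _; rewrite abse_EFin normrM (ger0_norm (K0 _)) EFinM /=; over.
rewrite ge0_integralZr//; last first.
- by move=> x _; rewrite lee_fin.
- by apply/measurable_EFinP; exact: measurableT_comp.
rewrite abseM lee_wpmul2r//.
by rewrite (le_trans (KC _))// lee_fin ler_norm.
Qed.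

(** The product is dominated by [M * K * f] for almost every [x] only. The comparison is therefore
    made on the iterated integral with outer variable [x], where a null set of [x] is harmless. *)
Lemma integrable_kernel_ess_bounded (K : T1 * T2 -> R) (C M : R)
    (f : T2 -> R) (g : T1 -> R) :
  measurable_fun setT K -> (forall z, 0 <= K z) ->
  (forall y, \int[m1]_x (K (x, y))%:E <= C%:E)%E ->
  m2.-integrable setT (EFin \o f) -> measurable_fun setT g ->
  (\forall x \ae m1, `|g x| <= M) ->
  (m1 \x m2)%E.-integrable setT (fun z => (K z * f z.2 * g z.1)%:E).
Proof.
move=> mK K0 KC fi mg gM.
have Kfi := integrable_kernel_snd _ _ _ mK K0 KC fi.
have mKf : measurable_fun setT (fun z : T1 * T2 => K z * f z.2).
  by apply/measurable_EFinP; exact: measurable_int Kfi.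
have mKfg : measurable_fun setT (fun z : T1 * T2 => (K z * f z.2 * g z.1)%:E).
  by apply/measurable_EFinP/measurable_funM => //; exact: measurableT_comp.
apply/integrable12ltyP => //.
have /integrable12ltyP := integrableZl measurableT M Kfi.
have mMKf : measurable_fun setT
    (fun z : T1 * T2 => (M%:E * (K z * f z.2)%:E)%E).
  exact/measurable_funeM/measurable_EFinP.
move=> /(_ mMKf); apply: le_lt_trans.
apply: ae_ge0_le_integral => //.
- by move=> x _; exact: integral_ge0.
- apply: (measurable_fun_fubini_tonelli_F
    (fun z => `|(K z * f z.2 * g z.1)%:E|)%E) => //.
  exact: measurableT_comp.
- by move=> x _; exact: integral_ge0.
- apply: (measurable_fun_fubini_tonelli_F
    (fun z => `|M%:E * (K z * f z.2)%:E|)%E) => //.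
  exact: measurableT_comp.
move: gM; apply: filterS => x gM _; apply: ge0_le_integral => //.
- by apply: measurableT_comp => //; exact: (measurable_fun_pair2 x mKfg).
- by apply: measurableT_comp => //; exact: (measurable_fun_pair2 x mMKf).
move=> y _; rewrite abse_EFin lee_fin mulrC !normrM ler_wpM2r ?mulr_ge0//.
by rewrite (le_trans gM)// ler_norm.
Qed.

End schur_test.

Lemma Lfun_pinfty_bounded {d} {T : measurableType d} {R : realType}
    (mu : {measure set T -> \bar R}) (f : T -> R) :
  f \in Lfun mu +oo%E -> exists M, \forall x \ae mu, `|f x| <= M.
Proof.
move=> /[!inE]/= /andP[_]; rewrite inE/= /finite_norm unlock.
case: ifPn => [_|].
  exact: (@ess_supr_bounded _ _ _ mu (Num.norm \o f)).
(* The norm at [+oo] is defined by cases on whether the space has positive measure; in a null space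
   any bound holds almost everywhere. *)
rewrite -leNgt => mu0 _; exists 0; exists setT; split => //.
by apply/eqP; rewrite -measure_le0.
Qed.

Section schur_test_Lfun.
Context {d1 d2} {T1 : measurableType d1} {T2 : measurableType d2}
  {R : realType}.
Variable m1 : {sigma_finite_measure set T1 -> \bar R}.
Variable m2 : {sigma_finite_measure set T2 -> \bar R}.

Lemma integrable_kernel_Lfun (p q : \bar R) (K : T1 * T2 -> R) (C : R)
    (f : T2 -> R) (g : T1 -> R) :
  (1 <= p)%E -> (1 <= q)%E -> (p^-1 + q^-1 = 1)%E ->
  measurable_fun setT K -> (forall z, 0 <= K z) ->
  (forall y, \int[m1]_x (K (x, y))%:E <= C%:E)%E ->
  (forall x, \int[m2]_y (K (x, y))%:E <= C%:E)%E ->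
  f \in Lfun m2 p -> g \in Lfun m1 q ->
  (m1 \x m2)%E.-integrable setT (fun z => (K z * f z.2 * g z.1)%:E).
Proof.
move=> p1 q1 pq mK K0 KC1 KC2 fp gq.
have mf : measurable_fun setT f by apply: set_mem; exact: sub_Lfun_mfun fp.
have mg : measurable_fun setT g by apply: set_mem; exact: sub_Lfun_mfun gq.
case: p p1 pq fp => [r| |]// r1 pq fr; last first.
  move: pq; rewrite invey add0e => /eqP; rewrite inve_eq1 => /eqP qE.
  have [M fM] := Lfun_pinfty_bounded _ _ fr.
  move: gq; rewrite qE => /Lfun1_integrable gi.
  (* Here [f] is the bounded factor, so the two variables exchange roles. *)
  have := integrable_kernel_ess_bounded m2 m1 (K \o swap_pair) C M g f
    (measurableT_comp mK (@measurable_swap _ _ T2 T1)) (fun=> K0 _)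
    KC2 gi mf fM.
  move=> /integrable_swap; apply: eq_integrable => // -[x y] _ /=.
  by rewrite mulrAC.
case: q q1 pq gq => [s| |]// s1 pq gs; last first.
  move: pq; rewrite invey adde0 => /eqP; rewrite inve_eq1 => /eqP rE.
  have [M gM] := Lfun_pinfty_bounded _ _ gs.
  move: fr; rewrite rE => /Lfun1_integrable fi.
  exact: (integrable_kernel_ess_bounded _ _ _ C M).
have r0 : 0 < r by rewrite (lt_le_trans ltr01).
have s0 : 0 < s by rewrite (lt_le_trans ltr01).
move: pq; rewrite !inver !gt_eqF// => -[] rs.
have fi := Lfun_integrable r1 fr.
have gi := Lfun_integrable s1 gs.
(* [Kf] and [Kg] are the two terms of Young's inequality multiplied by [K]: the one in [f] uses the
   bound on the integral of [K] in [x], the one in [g] the bound in [y]. *)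
have Kf := integrable_kernel_snd m1 m2 _ _ _ mK K0 KC1
  (integrableZl measurableT r^-1 fi).
have Kg := integrable_swap _ _ _
  (integrable_kernel_snd m2 m1 (K \o swap_pair) _ _
  (measurableT_comp mK (@measurable_swap _ _ T2 T1)) (fun=> K0 _) KC2
  (integrableZl measurableT s^-1 gi)).
apply: le_integrable (integrableD _ Kf Kg) => //.
  apply/measurable_EFinP; apply: measurable_funM; last exact: measurableT_comp.
  by apply: measurable_funM => //; exact: measurableT_comp.
move=> [x y] _ /=; rewrite lee_fin.
rewrite -mulrA !normrM (ger0_norm (K0 _)) -mulrDr normrM (ger0_norm (K0 _)).
rewrite ler_wpM2l//.
rewrite (le_trans (conjugate_powR (normr_ge0 _) (normr_ge0 _) r0 s0 rs))//.
by rewrite (le_trans _ (ler_norm _))// (mulrC r^-1) (mulrC s^-1).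
Qed.

End schur_test_Lfun.

(** An integrable function is finite almost everywhere. This reconciles inner integrals taken as
    real numbers by [Rintegral] with the extended-real ones of Fubini's theorem. *)
Lemma integral_fine_integrable {d} {T : measurableType d} {R : realType}
    (mu : {measure set T -> \bar R}) (D : set T) (F : T -> \bar R) :
  measurable D -> mu.-integrable D F ->
  (\int[mu]_(x in D) (fine (F x))%:E = \int[mu]_(x in D) F x)%E.
Proof.
move=> mD Fi; have mF := measurable_int _ Fi.
apply: ae_eq_integral => //.
  exact/measurable_EFinP/(measurableT_comp (fine_measurable _)).
by move: (integrable_ae mD Fi); apply: filterS => x /[apply] /fineK.
Qed.

(** * The exponential integral as a kernel *)

Section exponential_integral.
Context {R : realType}.
Notation mu := (@lebesgue_measure R).

(* For [0 <= s] the power [s `^ (-1)] is [s^-1]. *)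
Definition E1_integrand (z : R * R) : R :=
  if (0 <= z.1) && (z.1 <= z.2) then expR (- z.2) * z.2 `^ (-1) else 0.

Lemma E1_integrand_ge0 z : 0 <= E1_integrand z.
Proof.
rewrite /E1_integrand; case: ifP => // _.
by rewrite mulr_ge0 ?expR_ge0 ?powR_ge0.
Qed.

Lemma measurable_E1_integrand : measurable_fun setT E1_integrand.
Proof.
apply: measurable_fun_ifT => //.
  by apply: measurable_and; exact: measurable_fun_ler.
apply: measurable_funM.
  by apply: measurableT_comp => //; exact: measurableT_comp.
by apply: (measurableT_comp (f := fun s => s `^ (-1))).
Qed.

(** Extension by zero to [u < 0] makes the kernel vanish off the triangle [t <= x]. Being a partial
    integral of a nonnegative function on the plane, the extension is measurable by Tonelli. *)
Lemma E1_restrictE (u : R) :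
  (@E1 R \_ `[0, +oo[) u = fine (\int[mu]_s (E1_integrand (u, s))%:E).
Proof.
rewrite patchE mem_setE in_itv/= andbT; case: ifPn => u0; last first.
  by rewrite integral0_eq// => s _; rewrite /E1_integrand/= (negbTE u0).
rewrite /E1 Rintegral_mkcond; apply: eq_Rintegral => s _.
rewrite patchE mem_setE in_itv/= andbT /E1_integrand/= u0/=.
by case: ifPn => // us; rewrite powR_inv1// (le_trans u0).
Qed.

Lemma E1_restrict_ge0 (u : R) : 0 <= (@E1 R \_ `[0, +oo[) u.
Proof.
rewrite E1_restrictE fine_ge0// integral_ge0// => s _.
by rewrite lee_fin E1_integrand_ge0.
Qed.

Lemma measurable_E1_restrict : measurable_fun setT (@E1 R \_ `[0, +oo[).
Proof.
rewrite (_ : _ \_ _ =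
    fine \o (fun u => \int[mu]_s (E1_integrand (u, s))%:E)%E); last first.
  by apply/funext => u; rewrite E1_restrictE.
apply: (measurableT_comp (fine_measurable measurableT)).
apply: (measurable_fun_fubini_tonelli_F (m2 := mu)
  (EFin \o E1_integrand)) => //.
- by apply/measurable_EFinP; exact: measurable_E1_integrand.
- by move=> z; rewrite lee_fin E1_integrand_ge0.
Qed.

(* The bound comes from exchanging the integral in [x] with the one defining
   [E1]: the section at [s] of the region [0 <= h x <= s] has measure at most
   [alpha * s], which cancels the denominator of [expR (- s) / s]. *)
Lemma integral_E1_comp_le (h : R -> R) (alpha : R) :
  0 <= alpha -> measurable_fun setT h ->
  (forall s : R, 0 <= s -> (mu (h @^-1` `[0%R, s]) <= (alpha * s)%:E)%E) ->
  (\int[mu]_x ((@E1 R \_ `[0, +oo[) (h x))%:E <= alpha%:E)%E.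
Proof.
move=> alpha0 mh hs.
pose G (z : R * R) := (E1_integrand (h z.1, z.2))%:E.
have mG : measurable_fun setT G.
  apply/measurable_EFinP; apply: (measurableT_comp measurable_E1_integrand).
  by apply: measurable_fun_pair => //; exact: measurableT_comp.
have G0 z : (0 <= G z)%E by rewrite lee_fin E1_integrand_ge0.
apply: (@le_trans _ _ (\int[mu]_x \int[mu]_s G (x, s))%E).
  apply: ge0_le_integral => //.
  - by move=> x _; rewrite lee_fin E1_restrict_ge0.
  - by apply/measurable_EFinP; exact: (measurableT_comp measurable_E1_restrict).
  - exact: (measurable_fun_fubini_tonelli_F (m2 := mu) G).
  move=> x _; rewrite E1_restrictE/= -/(G (x, _)).
  (* Only an inequality is claimed: where the inner integral is [+oo], [fine] returns 0. *)
  have : (0 <= \int[mu]_s G (x, s))%E by exact: integral_ge0.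
  by rewrite /G/=; case: (integral _ _ _) => //= _; rewrite leey.
rewrite fubini_tonelli//.
(* The exponential density of rate 1 has total mass 1, so it suffices to bound the inner integral at
   each [s] by [alpha] times this density. *)
apply: (@le_trans _ _
  (\int[mu]_s (alpha%:E * (exponential_pdf 1 s)%:E))%E); last first.
  rewrite ge0_integralZl//.
  - by rewrite integral_exponential_pdf// mule1.
  - by apply/measurable_EFinP; exact: measurable_exponential_pdf.
  - by move=> s _; rewrite lee_fin exponential_pdf_ge0.
apply: ge0_le_integral => //.
- by move=> s _; exact: integral_ge0.
- exact: (measurable_fun_fubini_tonelli_G (m1 := mu) G).
- apply/measurable_funeM/measurable_EFinP; exact: measurable_exponential_pdf.
move=> /= s _; pose c : R := expR (- s) * s `^ (-1).
pose A : set R := h @^-1` `[0, s : R].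
have -> : (\int[mu]_x G (x, s) = \int[mu]_(x in A) c%:E)%E.
  rewrite [RHS]integral_mkcond; apply: eq_integral => x _.
  have -> : ((fun=> c%:E) \_ A) x = if 0 <= h x <= s then c%:E else 0%E.
    rewrite patchE (_ : (x \in A) = (h x \in `[0, s : R])) ?in_itv//.
    by apply/idP/idP; rewrite inE.
  by rewrite /G /E1_integrand/=; case: ifP.
rewrite integral_cst//; last first.
  by rewrite -[X in measurable X]setTI; exact: mh.
have [s0|s0] := leP 0 s; last first.
  have -> : A = set0.
    apply/seteqP; split => x //=; rewrite /A/= in_itv/= => /andP[h0 hxs].
    by move: (le_trans h0 hxs); rewrite leNgt s0.
  by rewrite measure0 mule0 mule_ge0// lee_fin exponential_pdf_ge0.
apply: (@le_trans _ _ (c%:E * (alpha * s)%:E)%E).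
  by rewrite lee_wpmul2l ?hs// lee_fin mulr_ge0 ?expR_ge0 ?powR_ge0.
rewrite -!EFinM lee_fin exponential_pdfE// mul1r mulN1r /c powR_inv1//.
rewrite mulrCA ler_wpM2l// -mulrA -[leRHS]mulr1 ler_wpM2l ?expR_ge0//.
(* At [s = 0] the product [s^-1 * s] is 0 instead of 1, which still gives the inequality. *)
by have [->|sn0] := eqVneq s 0; rewrite ?mulr0// mulVf.
Qed.

(** For fixed [t], the points [x] with [0 <= (x - t) / alpha <= s] form an interval of length
    [alpha * s] starting at [t]; with [x] fixed instead, the points [t] form one ending at [x]. *)
Lemma integral_E1_left_le (alpha t : R) : 0 < alpha ->
  (\int[mu]_x ((@E1 R \_ `[0, +oo[) ((x - t) / alpha))%:E <= alpha%:E)%E.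
Proof.
move=> alpha0; apply: (integral_E1_comp_le (fun x => (x - t) / alpha)).
- exact: ltW.
- by apply: measurable_funM => //; exact: measurable_funB.
move=> s s0; rewrite [X in mu X](_ : _ = `[t, t + alpha * s]%classic).
  rewrite lebesgue_measure_itv/=; case: ifPn => _; last first.
    by rewrite lee_fin mulr_ge0// ltW.
  by rewrite -EFinB addrAC subrr add0r.
apply/seteqP; split => x /=; rewrite !in_itv/=;
  by rewrite ler_pdivlMr// mul0r subr_ge0 ler_pdivrMr// lerBlDl (mulrC s).
Qed.

Lemma integral_E1_right_le (alpha x : R) : 0 < alpha ->
  (\int[mu]_t ((@E1 R \_ `[0, +oo[) ((x - t) / alpha))%:E <= alpha%:E)%E.
Proof.
move=> alpha0; apply: (integral_E1_comp_le (fun t => (x - t) / alpha)).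
- exact: ltW.
- by apply: measurable_funM => //; exact: measurable_funB.
move=> s s0; rewrite [X in mu X](_ : _ = `[x - alpha * s, x]%classic).
  rewrite lebesgue_measure_itv/=; case: ifPn => _; last first.
    by rewrite lee_fin mulr_ge0// ltW.
  by rewrite -EFinB opprB addrCA subrr addr0.
apply/seteqP; split => t /=; rewrite !in_itv/=;
  rewrite ler_pdivlMr// mul0r subr_ge0 ler_pdivrMr// (mulrC s) andbC;
  by rewrite lerBlDr -lerBlDl.
Qed.

(** Fubini's theorem calls for a domain independent of [x]: the truncated kernel removes [t > x],
    the truncated [f] removes [t < a], and [t <= b] follows from [t <= x <= b]. *)
Lemma fracint_left_restrictE (alpha a b : R) (f : R -> R) (x : R) :
  0 < alpha -> x \in `[a, b] ->
  fracint_left alpha a f x = alpha^-1 *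
    \int[mu]_t ((@E1 R \_ `[0, +oo[) ((x - t) / alpha) * (f \_ `[a, b]) t).
Proof.
rewrite in_itv/= => alpha0 /andP[ax xb].
rewrite /fracint_left Rintegral_mkcond; congr (_ * _).
apply: eq_Rintegral => t _; rewrite !patchE !mem_setE !in_itv/= andbT.
rewrite ler_pdivlMr// mul0r subr_ge0.
have [tx|xt] := leP t x; last by rewrite andbF mul0r.
by rewrite andbT (le_trans tx xb) andbT; case: ifP => _; rewrite ?mulr0.
Qed.

Lemma fracint_right_restrictE (alpha a b : R) (g : R -> R) (x : R) :
  0 < alpha -> x \in `[a, b] ->
  fracint_right alpha b g x = alpha^-1 *
    \int[mu]_t ((@E1 R \_ `[0, +oo[) ((t - x) / alpha) * (g \_ `[a, b]) t).
Proof.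
rewrite in_itv/= => alpha0 /andP[ax xb].
rewrite /fracint_right Rintegral_mkcond; congr (_ * _).
apply: eq_Rintegral => t _; rewrite !patchE !mem_setE !in_itv/= andbT.
rewrite ler_pdivlMr// mul0r subr_ge0.
have [xt|tx] := leP x t; last by rewrite mul0r.
by rewrite (le_trans ax xt); case: ifP => _; rewrite ?mulr0.
Qed.

End exponential_integral.

(** * Exchange of the two integrals *)

Theorem theorem2p3 (R : realType) (p q : \bar R)
    (p1 : (1 <= p)%E) (q1 : (1 <= q)%E) (pq : (p^-1 + q^-1 = 1)%E)
    (alpha : R) (alpha0 : 0 < alpha) (a b : R) (ab : a < b)
    (f g : R -> R) (hf : Lp_itv p a b f) (hg : Lp_itv q a b g) :
  (\int[@lebesgue_measure R]_(x in `[a, b])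
      (fracint_left alpha a f x * g x)%:E
   = \int[@lebesgue_measure R]_(x in `[a, b])
      (fracint_right alpha b g x * f x)%:E)%E.
Proof.
pose mu := @lebesgue_measure R.
pose f0 := f \_ `[a, b]; pose g0 := g \_ `[a, b].
have mf0 : measurable_fun setT f0 by apply: set_mem; exact: sub_Lfun_mfun hf.
have mg0 : measurable_fun setT g0 by apply: set_mem; exact: sub_Lfun_mfun hg.
pose K (z : R * R) := (@E1 R \_ `[0, +oo[) ((z.1 - z.2) / alpha).
have K0 z : 0 <= K z by exact: E1_restrict_ge0.
have mK : measurable_fun setT K.
  apply: (measurableT_comp measurable_E1_restrict).
  by apply: measurable_funM => //; exact: measurable_funB.
pose H (z : R * R) := alpha^-1 * (K z * f0 z.2 * g0 z.1).
have Hi : (mu \x mu)%E.-integrable setT (EFin \o H).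
  have Ki : (mu \x mu)%E.-integrable setT
      (fun z => (K z * f0 z.2 * g0 z.1)%:E).
    apply: (integrable_kernel_Lfun _ _ p q _ alpha) => //.
    - by move=> t; exact: integral_E1_left_le.
    - by move=> x; exact: integral_E1_right_le.
  have := integrableZl measurableT alpha^-1 Ki.
  exact: eq_integrable.
transitivity (\int[mu]_x \int[mu]_t (H (x, t))%:E)%E.
  have Hxi := integrable_fubini_F Hi.
  rewrite -(integral_fine_integrable _ _ _ measurableT Hxi).
  rewrite [LHS]integral_mkcond; apply: eq_integral => x _; rewrite /fubini_F/=.
  (* Outside [[a, b]] the factor [g0 x] makes the inner integral vanish. *)
  rewrite patchE mem_setE; case: ifPn => xab; last first.
    rewrite integral0_eq// => t _; rewrite /H /g0/= patchE mem_setE.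
    by rewrite (negbTE xab) !mulr0.
  rewrite (fracint_left_restrictE _ _ b)// mulrAC.
  (* The section of [H] at [x] is known to be integrable only for almost every [x], whereas the
     constant [alpha^-1 * g x] has to enter the integral at every [x] of [[a, b]]; measurability
     suffices for this. *)
  rewrite -RintegralZl_measurable//; last first.
    apply: measurable_funM => //.
    exact: (measurable_fun_pair2 x mK).
  congr EFin; apply: eq_Rintegral => t _.
  have g0x : g0 x = g x by rewrite /g0 patchE mem_setE xab.
  by rewrite /H/= g0x -!mulrA; congr (_ * _); rewrite mulrC -mulrA.
transitivity (\int[mu]_x \int[mu]_t (H (t, x))%:E)%E; first exact: (Fubini Hi).
(* After the exchange the outer variable is the second argument of [H], so the same argument runs on
   the swapped function, with [f0] as the outer factor. *)
have Hsi := integrable_fubini_F (integrable_swap _ _ _ Hi).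
rewrite -(integral_fine_integrable _ _ _ measurableT Hsi).
rewrite [RHS]integral_mkcond; apply: eq_integral => x _; rewrite /fubini_F/=.
rewrite patchE mem_setE; case: ifPn => xab; last first.
  rewrite integral0_eq// => t _; rewrite /H /f0/= patchE mem_setE.
  by rewrite (negbTE xab) mulr0 mul0r mulr0.
rewrite (fracint_right_restrictE _ a)// mulrAC.
rewrite -RintegralZl_measurable//; last first.
  apply: measurable_funM => //.
  exact: (measurable_fun_pair1 x mK).
congr EFin; apply: eq_Rintegral => t _.
have f0x : f0 x = f x by rewrite /f0 patchE mem_setE xab.
by rewrite /H/= f0x -!mulrA (mulrCA (f x)).
Qed.
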